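(* There exist two decreasing gap asymptotically dense type 2 sets $\Lambda_1$ and $\Lambda_2$ such that their union $\Lambda_1\cup\Lambda_2$ is type 1.
   Context: A set $\Lambda\subset\mathbb{R}$ is called admissible if it is countably infinite, unbounded, bounded from below, and has no finite accumulation points; type 1 and type 2 sets are by definition admissible. An admissible set $\Lambda=\{\lambda_1,\lambda_2,\dots\}$ with $\lambda_1<\lambda_2<\dots$ is asymptotically dense if $d_n=\lambda_n-\lambda_{n-1}\to 0$; if moreover $d_n$ tends to zero monotonically (i.e. $(d_n)$ is non-increasing), $\Lambda$ is called decreasing gap asymptotically dense. Let $\mu$ denote Lebesgue measure on $\mathbb{R}$. For an admissible $\Lambda$ and a (Lebesgue) measurable $f:\mathbb{R}\to[0,+\infty)$, put $s(x)=\sum_{\lambda\in\Lambda}f(x+\lambda)$, $C(f,\Lambda)=\{x\in\mathbb{R}: s(x)<\infty\}$ and $D(f,\Lambda)=\{x\in\mathbb{R}: s(x)=\infty\}$. The set $\Lambda$ is type 1 if for every measurable $f:\mathbb{R}\to[0,+\infty)$ either $\mu(D(f,\Lambda))=0$ or $\mu(C(f,\Lambda))=0$. Otherwise $\Lambda$ is type 2. *)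

(* Defs.v *)
From HB Require Import structures.
From mathcomp Require Import all_boot all_order all_algebra.
From mathcomp Require Import all_classical all_reals all_analysis.

Set Implicit Arguments.
Unset Strict Implicit.
Unset Printing Implicit Defensive.

Import Order.TTheory GRing.Theory Num.Theory.
Import numFieldNormedType.Exports.

Local Open Scope classical_set_scope.
Local Open Scope ring_scope.

(* [R] with the sigma-algebra of Lebesgue (not merely Borel) measurable sets:
   the Caratheodory sigma-algebra on which [completed_lebesgue_measure] is
   defined. *)
Definition lebesgueType (R : realType) :=
  caratheodory_type (@wlength R idfun)^*%mu.

(* The target carries the Borel sigma-algebra. *)
Definition lebesgue_measurable_fun (R : realType) (f : R -> R) : Prop :=
  measurable_fun [set: lebesgueType R] (f : lebesgueType R -> measurableTypeR R).

Definition admissible (R : realType) (L : set R) : Prop :=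
  [/\ countable L, infinite_set L, ~ bounded_set L, has_lbound L
    & limit_point L = set0].

(* For a given [L] there is at most one such [u]. *)
Definition increasing_enumeration (R : realType) (u : R^nat) (L : set R) : Prop :=
  increasing_seq u /\ range u = L.

Definition gap (R : realType) (u : R^nat) : R^nat := [sequence u n.+1 - u n]_n.

Definition asymptotically_dense (R : realType) (L : set R) : Prop :=
  admissible L /\
  exists2 u : R^nat, increasing_enumeration u L & gap u @ \oo --> (0 : R).

Definition decreasing_gap_asymptotically_dense (R : realType) (L : set R) : Prop :=
  asymptotically_dense L /\
  exists2 u : R^nat, increasing_enumeration u L & nonincreasing_seq (gap u).

Definition translate_sum (R : realType) (f : R -> R) (L : set R) (x : R) : \bar R :=
  \esum_(l in L) (f (x + l))%:E.

Definition convergence_set (R : realType) (f : R -> R) (L : set R) : set R :=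
  [set x | (translate_sum f L x < +oo)%E].

Definition divergence_set (R : realType) (f : R -> R) (L : set R) : set R :=
  [set x | translate_sum f L x = +oo%E].

Definition type1 (R : realType) (L : set R) : Prop :=
  admissible L /\
  forall f : R -> R, lebesgue_measurable_fun f -> (forall x, 0 <= f x) ->
    completed_lebesgue_measure (divergence_set f L) = 0%E \/
    completed_lebesgue_measure (convergence_set f L) = 0%E.

Definition type2 (R : realType) (L : set R) : Prop :=
  admissible L /\ ~ type1 L.

(* Main.v *)
Require Import Defs.
From mathcomp Require Import all_boot all_order all_algebra.
From mathcomp Require Import all_classical all_reals all_analysis.
From mathcomp Require Import measurable_realfun.
From mathcomp Require Import zify ring lra.

(** Both sets have the form
    Lambda_e = {t >= 0 | t is a multiple of 2^-e(k), k = floor t}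
    with e : nat -> nat nondecreasing and unbounded: on [k, k+1) the set is a
    dyadic grid, refined as k grows, so its gaps decrease to 0
    ([refining_grid_decreasing_gap]).  Whether Lambda_e is type 1 depends on the
    size of the jumps e(k+1) - e(k).

    Unbounded jumps give type 2 ([type2_refining_grid]).  At a jump at the
    integer n, from step 2^-m to the much smaller step w, take f to be the
    indicator of [n, n+w).  A point x < 0 sees this interval through the fine
    grid on the right of n and hits it; a point x > 0 sees it through the coarse
    grid on the left of n and hits it only if x lies within w of that grid,
    which is rare.  Adding up over jumps of increasing size gives divergence on
    [-1/2, 0] and a zero sum on most of [1/2, 1].

    Jumps of size at most 1 give type 1 ([type1_refining_grid]).  Write s(x) for
    the sum of f over x + Lambda_e, and replace it by the sum T_c(x) in which
    the step of the grid is dictated by the position of the point x + l relative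
    to a fixed c instead of relative to x ([comb_sum]).  Then s <= T_c on
    [c, +oo) and T_c <= s on (-oo, c].  A dyadic translation of x changes only
    finitely many terms of T_c, hence {T_c < +oo} is null or conull
    ([dyadic_zero_one], by Lebesgue density).  Passing from T_(c+1) to T_c
    refines each grid at most once: up to a finite term, T_c is bounded by the
    sum of T_(c+1) and a copy of it whose k-th part is translated by 2^-e(k+1).
    All parts after the k-th are invariant under that translation, so a stopping
    argument in the spirit of the conditional Borel-Cantelli lemma shows that
    the translated series still converges almost everywhere ([null_sum_shift]).
    Thus the alternative for T_c does not depend on c, and s is finite almost
    everywhere or infinite almost everywhere.

    It remains to choose exponents e and e' with unbounded jumps such that
    max(e, e')(k) = k + 1.  On the dyadic blocks [2^t, 2^(t+1)) one exponent
    climbs by 1 at each step while the other one stalls at 2^t, and the roles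
    alternate with the parity of t ([stalling]); whichever stalled catches up in
    one long jump at the end of the block, while the maximum climbs steadily.
    The union of the two sets is Lambda_max(e, e'). *)

Set Implicit Arguments.
Unset Strict Implicit.
Unset Printing Implicit Defensive.

Import Order.TTheory GRing.Theory Num.Theory.
Import numFieldNormedType.Exports.

Local Open Scope classical_set_scope.
Local Open Scope ring_scope.

(** * Refining dyadic grids *)

Definition grid (R : realType) (m : nat) : set R :=
  range (fun i : int => i%:~R / 2 ^+ m).

Definition refining_grid (R : realType) (e : nat -> nat) : set R :=
  [set t | 0 <= t /\ grid (e (Num.truncn t)) t].

Lemma grid0 (R : realType) m : grid m (0 : R).
Proof. by exists 0 => //; rewrite mul0r. Qed.

Lemma gridN (R : realType) m (x : R) : grid m x -> grid m (- x).
Proof. by move=> [i _ <-]; exists (- i) => //; rewrite mulrNz mulNr. Qed.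

Lemma gridD (R : realType) m (x y : R) : grid m x -> grid m y -> grid m (x + y).
Proof.
by move=> [i _ <-] [j _ <-]; exists (i + j) => //; rewrite intrD mulrDl.
Qed.

Lemma gridB (R : realType) m (x y : R) : grid m x -> grid m y -> grid m (x - y).
Proof. by move=> ? ?; apply: gridD => //; exact: gridN. Qed.

Lemma grid_step (R : realType) m : grid m (2 ^- m : R).
Proof. by exists 1 => //; rewrite mul1r. Qed.

Lemma sub_grid (R : realType) m m' : (m <= m')%N -> @grid R m `<=` grid m'.
Proof.
move=> mm' _ [i _ <-]; exists (i * (2 ^+ (m' - m))) => //.
by rewrite intrM rmorphXn/= -{2}(subnK mm') exprD invfM mulrA mulfK ?expf_neq0.
Qed.

Lemma grid_nat (R : realType) m n : grid m (n%:R : R).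
Proof.
by apply: (@sub_grid R 0 m) => //; exists n%:Z => //; rewrite expr0 divr1.
Qed.

Lemma grid_lt_step (R : realType) m (x : R) :
  grid m x -> 0 <= x -> x < 2 ^- m -> x = 0.
Proof.
move=> [i _ <-]; rewrite pmulr_lge0 ?invr_gt0 ?exprn_gt0// ler0z.
rewrite -[X in _ < X]mul1r ltr_pM2r ?invr_gt0 ?exprn_gt0// -[1]/(1%:~R) ltr_int.
move=> i0 i1; have -> : i = 0 by lia.
by rewrite mul0r.
Qed.

Lemma gridS_split (R : realType) m (x : R) :
  grid m.+1 x -> grid m x \/ grid m (x - 2 ^- m.+1).
Proof.
move=> [i _ <-].
have E (j : int) : (j * 2)%:~R / 2 ^+ m.+1 = j%:~R / 2 ^+ m :> R.
  by rewrite intrM exprS invfM mulrA mulfK ?pnatr_eq0.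
have [j [-> | ->]] : exists j : int, i = (j * 2) \/ i = (j * 2 + 1).
  by exists (i %/ 2)%Z; lia.
- by left; rewrite E; exists j.
- by right; rewrite intrD mulrDl mul1r addrK E; exists j.
Qed.

Lemma expr2V_le1 (R : realType) m : 2 ^- m <= 1 :> R.
Proof. by rewrite invf_le1 ?exprn_gt0// exprn_ege1// ler1n. Qed.

Lemma le_expr2V (R : realType) m n : (m <= n)%N -> 2 ^- n <= 2 ^- m :> R.
Proof.
by move=> mn; rewrite lef_pV2 ?posrE ?exprn_gt0// ler_weXn2l// ler1n.
Qed.

Lemma exists_expr2V_lt (R : realType) (eps : R) : 0 < eps ->
  exists m, 2 ^- m < eps.
Proof.
move=> eps0.
have /cvgrPdist_lt/(_ _ eps0)[m _ /(_ m (leqnn m))/= em] :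
    (GRing.exp (2^-1 : R) : R^nat) @ \oo --> (0 : R).
  by apply: cvg_expr; rewrite gtr0_norm// invf_lt1 ?ltr1n.
exists m; move: em; rewrite sub0r normrN exprVn ger0_norm//.
Qed.

(** The next integer is on the grid, so one step cannot jump over it. *)
Lemma truncn_add_step (R : realType) m (t : R) : 0 <= t -> grid m t ->
  t + 2 ^- m <= (Num.truncn t).+1%:R.
Proof.
move=> t0 gt; rewrite leNgt; apply/negP => lt.
have tlt := truncnS_gt t.
have /eqP : (Num.truncn t).+1%:R - t = 0.
  apply: (@grid_lt_step _ m); last by lra.
  - by apply: gridB => //; exact: grid_nat.
  - by rewrite subr_ge0 ltW.
by rewrite subr_eq0 => /eqP E; rewrite -[ltLHS]E ltxx in tlt.
Qed.

(** The increasing enumeration of [refining_grid e]: the successor of a point t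
    is one step of its own grid further, also when it is an integer, because
    integers belong to every grid. *)
Fixpoint grid_walk (R : realType) (e : nat -> nat) (n : nat) : R :=
  if n is n'.+1 then
    grid_walk R e n' + 2 ^- e (Num.truncn (grid_walk R e n'))
  else 0.

Lemma grid_walk_in (R : realType) e n : {homo e : i j / (i <= j)%N} ->
  refining_grid e (grid_walk R e n).
Proof.
move=> he; elim: n => [|n [u0 gu]]; first by split => //; exact: grid0.
have u1 : 0 <= grid_walk R e n.+1.
  by rewrite /= addr_ge0// invr_ge0 exprn_ge0.
split => //=; apply: (@sub_grid _ (e (Num.truncn (grid_walk R e n)))).
  by apply: he; apply: le_truncn; rewrite lerDl invr_ge0 exprn_ge0.
by apply: gridD => //; exact: grid_step.
Qed.

Lemma grid_walk_ge0 (R : realType) e n : 0 <= grid_walk R e n.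
Proof. by elim: n => [|n IH]//=; rewrite addr_ge0// invr_ge0 exprn_ge0. Qed.

Lemma grid_walk_lt (R : realType) e n : grid_walk R e n < grid_walk R e n.+1.
Proof. by rewrite ltrDl invr_gt0 exprn_gt0. Qed.

Lemma grid_walk_incr (R : realType) e : increasing_seq (grid_walk R e).
Proof. by apply/increasing_seqP; exact: grid_walk_lt. Qed.

Lemma grid_walk_unbounded (R : realType) e (t : R) :
  {homo e : i j / (i <= j)%N} -> exists n, t < grid_walk R e n.
Proof.
move=> he; apply: contrapT => /forallNP H.
have ub n : grid_walk R e n <= t by rewrite leNgt; apply/negP.
pose d : R := 2 ^- e (Num.truncn t).
have d0 : 0 < d by rewrite invr_gt0 exprn_gt0.
have lb n : n%:R * d <= grid_walk R e n.
  elim: n => [|n IH]; first by rewrite mul0r.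
  rewrite /= -natr1 mulrDl mul1r lerD//.
  by apply: le_expr2V; apply: he; exact: le_truncn.
have := le_trans (lb (Num.truncn (t / d)).+1) (ub _).
by rewrite -ler_pdivlMr// leNgt truncnS_gt.
Qed.

(** The walk is unbounded, so it passes t.  The last point u of the walk with
    u <= t lies in the same unit interval as t, because the step from u does not
    jump over an integer; so u and t are on the same grid, less than one step
    apart. *)
Lemma range_grid_walk (R : realType) e : {homo e : i j / (i <= j)%N} ->
  range (grid_walk R e) = refining_grid e.
Proof.
move=> he; apply/seteqP; split=> [_ [n _ <-]|t [t0 gt]];
  first exact: grid_walk_in.
have [[|n] /= tn tmin] := find_ex_minn (@grid_walk_unbounded R e t he).
  by rewrite ltNge t0 in tn.
set u := grid_walk R e n in tn *.
have ut : u <= t.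
  by rewrite leNgt; apply/negP => /tmin; rewrite ltnn.
have [u0 gu] := @grid_walk_in R e n he; rewrite -/u in u0 gu.
have E : Num.truncn t = Num.truncn u.
  apply: truncn_def; rewrite (lt_le_trans tn) ?truncn_add_step// andbT.
  by rewrite (le_trans _ ut)// truncn_le.
exists n => //; apply/esym/eqP; rewrite -subr_eq0; apply/eqP.
rewrite E in gt; apply: (@grid_lt_step _ (e (Num.truncn u))).
- exact: gridB.
- by rewrite subr_ge0.
- by rewrite ltrBlDl.
Qed.

Lemma refining_grid_enum (R : realType) e : {homo e : i j / (i <= j)%N} ->
  increasing_enumeration (grid_walk R e) (refining_grid e).
Proof. by move=> he; split; [exact: grid_walk_incr|exact: range_grid_walk]. Qed.

Lemma gap_grid_walk (R : realType) e n :
  gap (grid_walk R e) n = 2 ^- e (Num.truncn (grid_walk R e n)).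
Proof. by rewrite /gap /= addrC addKr. Qed.

Lemma gap_grid_walk_nonincr (R : realType) e : {homo e : i j / (i <= j)%N} ->
  nonincreasing_seq (gap (grid_walk R e)).
Proof.
move=> he; apply/nonincreasing_seqP => n; rewrite !gap_grid_walk.
by apply: le_expr2V; apply: he; apply: le_truncn; exact/ltW/grid_walk_lt.
Qed.

Lemma unbounded_not_bounded_set (R : realType) (A : set R) :
  (forall t, exists2 x, A x & t < x) -> ~ bounded_set A.
Proof.
move=> Aub [M [_ /(_ (M + 1))]]; rewrite ltrDl => /(_ ltr01) AM.
have [x /AM + Mx] := Aub (M + 1).
by rewrite /= => /(le_trans (ler_norm x)); rewrite leNgt Mx.
Qed.

Lemma unbounded_infinite_set (R : realType) (A : set R) :
  (forall t, exists2 x, A x & t < x) -> infinite_set A.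
Proof.
move=> /unbounded_not_bounded_set Aub /finite_compact.
by move=> /compact_bounded.
Qed.

(** The points in a ball of radius at most 1 around t all lie on one grid; if
    the diameter of the ball is a step of that grid, at most one of them is in
    the ball.  This excludes accumulation points. *)
Lemma refining_grid_admissible (R : realType) e : {homo e : i j / (i <= j)%N} ->
  admissible (@refining_grid R e).
Proof.
move=> he.
have ub (t : R) : exists2 x, refining_grid e x & t < x.
  have [n tn] := @grid_walk_unbounded R e t he.
  by exists (grid_walk R e n) => //; exact: grid_walk_in.
split.
- by rewrite -range_grid_walk//; exact: card_image_le.
- exact: unbounded_infinite_set.
- exact: unbounded_not_bounded_set.
- by exists 0 => x [].
- apply/seteqP; split=> // t /limit_point_infinite_setP.
  pose m := e (Num.truncn (t + 1)).
  have d0 : 0 < 2 ^- m.+1 :> R by rewrite invr_gt0 exprn_gt0.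
  have d1 := @expr2V_le1 R m.+1.
  move=> /(_ _ (nbhsx_ballx t _ d0)) Binf.
  have [p [Bp Lp]] := infinite_setN0 Binf.
  apply: Binf; apply: (@sub_finite_set _ _ [set p]) => // q [Bq Lq] /=.
  have fine x : ball t (2 ^- m.+1) x -> refining_grid e x -> grid m x.
    rewrite /ball/= ltr_norml => /andP[xt _] [_].
    by apply: sub_grid; apply: he; apply: le_truncn; lra.
  have dS : 2 ^- m = 2 ^- m.+1 + 2 ^- m.+1 :> R.
    by rewrite exprS invfM; field; rewrite expf_neq0.
  apply/eqP; rewrite -subr_eq0; apply/eqP.
  have gqp : grid m (q - p) by apply: gridB; exact: fine.
  move: Bp Bq; rewrite /ball/= !ltr_norml => /andP[? ?] /andP[? ?].
  have [qp|pq] := leP p q.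
    by apply: (grid_lt_step gqp); lra.
  apply: oppr_inj; rewrite oppr0.
  by apply: (grid_lt_step (gridN gqp)); lra.
Qed.

Lemma refining_grid_decreasing_gap (R : realType) e :
  {homo e : i j / (i <= j)%N} -> (forall m, exists k, (m <= e k)%N) ->
  decreasing_gap_asymptotically_dense (@refining_grid R e).
Proof.
move=> he e_unb.
split; last first.
  exists (grid_walk R e); first exact: refining_grid_enum.
  exact: gap_grid_walk_nonincr.
split; first exact: refining_grid_admissible.
exists (grid_walk R e); first exact: refining_grid_enum.
apply/cvgrPdist_le => /= eps eps0.
have [m em] := exists_expr2V_lt eps0.
have [k mk] := e_unb m.
have [n kn] := @grid_walk_unbounded R e k%:R he.
exists n => // j /= nj; rewrite gap_grid_walk.
rewrite sub0r normrN ger0_norm ?invr_ge0 ?exprn_ge0//; apply: le_trans (ltW em).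
apply: le_expr2V; apply: (leq_trans mk); apply: he.
rewrite truncn_ge_nat ?grid_walk_ge0//; apply/ltW/(lt_le_trans kn).
by rewrite grid_walk_incr.
Qed.

(** * Long jumps give type 2 *)

(** Negligibility makes sense for arbitrary sets, so convergence and divergence
    sets are handled without proving them measurable. *)
Definition null (R : realType) (A : set R) : Prop :=
  (@lebesgue_measure R).-negligible A.

(** The completed measure of an arbitrary set is its outer measure. *)
Lemma completed_lebesgue_measure0P (R : realType) (A : set R) :
  completed_lebesgue_measure A = 0%E <-> null A.
Proof. exact: (iff_sym (negligible_outer_measure _)). Qed.

Lemma sub_null (R : realType) (A B : set R) : A `<=` B -> null B -> null A.
Proof. exact: (@negligibleS _ (measurableTypeR R) R lebesgue_measure). Qed.

Lemma nullU (R : realType) (A B : set R) : null A -> null B -> null (A `|` B).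
Proof. exact: (@negligibleU _ (measurableTypeR R) R lebesgue_measure). Qed.

Lemma null_bigcup (R : realType) (A : (set R)^nat) :
  (forall k, null (A k)) -> null (\bigcup_k A k).
Proof. exact: (@negligible_bigcup _ (measurableTypeR R) R lebesgue_measure).
  Qed.

Lemma null_measure0 (R : realType) (A : set (measurableTypeR R)) :
  measurable A -> null A -> lebesgue_measure A = 0%E.
Proof. exact: (@measure_negligible _ (measurableTypeR R) R lebesgue_measure).
  Qed.

Lemma translate_sum_indic (R : realType) (F L : set R) (x : R) :
  translate_sum \1_F L x = \esum_(l in L `&` [set l | F (x + l)]) 1%E.
Proof.
rewrite esum_mkcondr; apply: eq_esum => l _.
have -> : (l \in [set l | F (x + l)]) = (x + l \in F).
  by apply/idP/idP; rewrite !inE.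
by rewrite indicE; case: (_ \in _).
Qed.

Lemma translate_sum_indic_pinfty (R : realType) (F L : set R) (x : R) :
  infinite_set (L `&` [set l | F (x + l)]) -> translate_sum \1_F L x = +oo%E.
Proof.
move=> Linf; rewrite translate_sum_indic -[RHS](infinite_card_dirac R Linf).
by apply: eq_esum => l Sl; rewrite diracE mem_set.
Qed.

Lemma translate_sum_indic0 (R : realType) (F L : set R) (x : R) :
  (forall l, L l -> ~ F (x + l)) -> translate_sum \1_F L x = 0%E.
Proof.
move=> FL; rewrite translate_sum_indic; apply: esum1 => l [/FL Fl].
by move/Fl.
Qed.

Lemma lebesgue_measurable_indic (R : realType) (F : set (measurableTypeR R)) :
  measurable F -> lebesgue_measurable_fun (\1_F : R -> R).
Proof.
move=> mF; have mF' : measurable (F : set (lebesgueType R)).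
  exact: sub_caratheodory.
move=> mT Y mY.
exact: (@measurable_realfun.measurable_indic _ (lebesgueType R) R setT F mF'
  mT Y mY).
Qed.

(** The function that separates is the indicator of a union F of short
    intervals [n, n + w), one to the right of each of a sequence of integers n
    where the step drops from 2^-m to w.  Points of [-1/2, 0] reach the interval
    through the grid of step w, hence always; points of [1/2, 1] only through
    the grid of step 2^-m, hence with probability about w 2^m, which is summable
    along the chosen sequence. *)
Lemma type2_refining_grid (R : realType) e : {homo e : i j / (i <= j)%N} ->
  (forall j, exists k, (e k + j <= e k.+1)%N) -> type2 (@refining_grid R e).
Proof.
move=> he jumps; split; first exact: refining_grid_admissible.
(* The condition j <= k j makes the selected jumps infinitely many; the
   summand 4 makes the total measure of the exceptional sets at most 1/4. *)
have /choice[k kP] : forall j, exists k, (e k + (j + 4) <= e k.+1 /\ j <= k)%N.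
  move=> j; have [k kP] := jumps (e j + (j + 4))%N; exists k; split;
    first by lia.
  by rewrite leqNgt; apply/negP => /he; lia.
pose w j : R := 2 ^- e (k j).+1.
pose F : set (measurableTypeR R) :=
  \bigcup_j `[(k j).+1%:R, (k j).+1%:R + w j[%classic.
have mF : measurable F by apply: bigcupT_measurable => j; exact: measurable_itv.
have w_gt0 j : 0 < w j by rewrite invr_gt0 exprn_gt0.
have w_le j : w j <= 2 ^- 4.
  by apply: le_expr2V; have [] := kP j; lia.
have w4 j : w j <= 1/16 by have := w_le j; lra.
case=> _ /(_ \1_F (lebesgue_measurable_indic mF)) [].
- by move=> x; rewrite indicE.
- move/completed_lebesgue_measure0P => D0.
  have sD : `[- (1 / 2), 0]%classic `<=`
      divergence_set \1_F (@refining_grid R e).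
    move=> x /=; rewrite in_itv/= => /andP[x1 x0].
    apply/translate_sum_indic_pinfty/unbounded_infinite_set => t.
    (* A translate of a grid of step w j meets every half-open interval of
       length w j. *)
    pose j := (Num.truncn t).+1.
    have tj : t < j%:R by exact: truncnS_gt.
    have [l [gl [lx lw]]] : exists l, grid (e (k j).+1) l /\
        ((k j).+1%:R <= x + l /\ x + l < (k j).+1%:R + w j).
      pose i := Num.ceil (((k j).+1%:R - x) * 2 ^+ e (k j).+1).
      exists (i%:~R / 2 ^+ e (k j).+1); split; first by exists i.
      have P0 : 0 < 2 ^+ e (k j).+1 :> R by rewrite exprn_gt0.
      rewrite -lerBlDl ler_pdivlMr// ceil_ge; split => //.
      rewrite -ltrBrDl addrAC ltr_pdivrMr// mulrDl mulVf ?gt_eqF//.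
      by have := ceilB1_lt (((k j).+1%:R - x) * 2 ^+ e (k j).+1);
        rewrite intrD; lra.
    have kj : j%:R <= (k j)%:R :> R by rewrite ler_nat; have [] := kP j.
    have kS : (k j).+1%:R = (k j)%:R + 1 :> R by rewrite -natr1.
    have l0 : (k j).+1%:R <= l by lra.
    exists l; last by lra.
    split; last by exists j => //=; rewrite in_itv/= lx lw.
    split; first exact: le_trans l0.
    apply: sub_grid gl; apply: he; rewrite truncn_ge_nat//.
    exact: le_trans l0.
  have := null_measure0 _ (sub_null sD D0).
  rewrite lebesgue_measure_itv/= lte_fin oppr_lt0 divr_gt0// -EFinB.
  move=> /(_ (measurable_itv _))/eqP.
  by rewrite eqe sub0r opprK gt_eqF ?divr_gt0.
- move/completed_lebesgue_measure0P => C0.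
  pose m j := e (k j).
  pose I j i : set (measurableTypeR R) :=
    `[i%:R / 2 ^+ m j, i%:R / 2 ^+ m j + w j[%classic.
  pose B j := \big[setU/set0]_(i < (2 ^ m j).+1) I j i.
  have mB j : measurable (B j).
    by apply: bigsetU_measurable => i _; exact: measurable_itv.
  have muB j : (lebesgue_measure (B j) <= ((1/4) / (2 ^ j.+1)%:R)%:E)%E.
    apply: (le_trans
      (@Boole_inequality _ _ _ lebesgue_measure (I j) _ _)) => [i _|].
      exact: measurable_itv.
    rewrite (eq_bigr (fun=> (w j)%:E)) => [|i _]; last first.
      apply: etrans (lebesgue_measure_itv _) _.
      by rewrite /= lte_fin ltrDl w_gt0 -EFinB addrAC subrr add0r.
    rewrite sumEFin lee_fin sumr_const card_ord -[leLHS]mulr_natl.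
    have wj : w j <= 2 ^- m j * (2 ^- j.+1 * 8^-1).
      have -> : 8 = 2 ^+ 3 :> R by rewrite -natrX.
      rewrite -!invfM -!exprD; apply: le_expr2V.
      by rewrite /m; have [] := kP j; lia.
    apply: (@le_trans _ _ ((2 * 2 ^+ m j) * (2 ^- m j * (2 ^- j.+1 * 8^-1)))).
      apply: ler_pM => //; first exact: ltW.
      by rewrite -natrX -natrM ler_nat; have := expn_gt0 2 (m j); lia.
    have : 2 ^+ m j * 2 ^- m j = 1 :> R by rewrite mulfV// expf_neq0.
    rewrite natrX; move: (2 ^+ m j) (2 ^- m j) => a b ab.
    rewrite -[2 * a * _]mulrA [a * _]mulrA ab mul1r; lra.
  (* If x >= 1/2 and x + l is in the j-th interval, then l is to the left of the
     jump, so that x is within w j of a multiple of 2 ^- m j. *)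
  have sC : `[1 / 2, 1]%classic `<=`
      convergence_set \1_F (@refining_grid R e) `|` \bigcup_j B j.
    move=> x /=; rewrite in_itv/= => /andP[x1 x2].
    have [Bx|Bx] := pselect ((\bigcup_j B j) x); [by right|left].
    rewrite /convergence_set/= translate_sum_indic0 ?ltry// => l [l0 gl] [j _].
    rewrite /= in_itv/= => /andP[kl lk]; apply: Bx; exists j => //.
    have wj := w4 j.
    have gl' : grid (m j) l.
      apply: sub_grid gl; apply: he; rewrite -ltnS truncn_lt_nat//.
      by lra.
    have [i _ iE] := gridB (grid_nat R (m j) (k j).+1) gl'.
    have P0 : 0 < 2 ^+ m j :> R by rewrite exprn_gt0.
    have i0 : (0 <= i).
      by rewrite -(ler0z R) -(pmulr_lge0 _ (_ : 0 < 2 ^- m j)) ?invr_gt0//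
        iE; lra.
    have im : (`|i| <= 2 ^ m j)%N.
      rewrite -(ler_nat R) natrX natr_absz ger0_norm//.
      by rewrite -[leRHS]mul1r -ler_pdivrMr// iE; lra.
    rewrite /B -(bigcup_mkord _ (I j)); exists `|i|%N => //=.
    by rewrite /I/= in_itv/= natr_absz ger0_norm// iE; apply/andP; split; lra.
  have [N [mN N0 CN]] := C0.
  have : (lebesgue_measure (`[(1 / 2)%R, 1%R]%classic : set R) <= (1/4)%:E)%E.
    have sN : `[1 / 2, 1]%classic `<=` N `|` \bigcup_j B j.
      by apply: (subset_trans sC); exact: setSU.
    have mBU : measurable (\bigcup_j B j) by exact: bigcupT_measurable.
    apply: (@le_trans _ _ (lebesgue_measure (N `|` \bigcup_j B j))).
      by apply: le_measure => //; rewrite inE;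
        [exact: measurable_itv|exact: measurableU].
    apply: (@le_trans _ _ (lebesgue_measure N + lebesgue_measure (\bigcup_j B
      j))%E).
      exact: measureU2.
    rewrite N0 add0e.
    apply: (@le_trans _ _ (\sum_(0 <= j <oo) lebesgue_measure (B j))%E).
      exact: measure_sigma_subadditive.
    apply: le_trans (epsilon_trick0 xpredT _); last by lra.
    by apply: lee_nneseries => [j *|j *]; [exact: measure_ge0|exact: muB].
  rewrite lebesgue_measure_itv/= lte_fin -EFinB.
  have -> : (1 / 2 < 1 :> R) by lra.
  by rewrite lee_fin; lra.
Qed.

(** * Translations and a dyadic zero-one law *)

Lemma grid_round_down (R : realType) m (x : R) :
  exists2 g, grid m g & x - 2 ^- m <= g <= x.
Proof.
pose i := Num.floor (x * 2 ^+ m); exists (i%:~R / 2 ^+ m); first by exists i.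
have P0 : 0 < 2 ^+ m :> R by rewrite exprn_gt0.
rewrite ler_pdivrMr// floor_le andbT ler_pdivlMr// mulrBl mulVf ?gt_eqF//.
by have := floorD1_gt (x * 2 ^+ m); rewrite -/i intrD; lra.
Qed.

Lemma measurable_shift (R : realType) (h : R) :
  measurable_fun [set: measurableTypeR R]
    ((fun x => x + h) : measurableTypeR R -> measurableTypeR R).
Proof.
have : measurable_fun setT (fun x : R => x + h) by exact: measurable_funD.
by move=> ms mT Y mY; exact: ms.
Qed.

Lemma lebesgue_measure_shift (R : realType) (h : R) (A : set (measurableTypeR
  R)) :
  measurable A ->
  pushforward lebesgue_measure
    ((fun x => x + h) : measurableTypeR R -> measurableTypeR R) A
  = lebesgue_measure A.
Proof.
move=> mA; apply/esym; apply: lebesgue_measure_unique => //;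
  first exact: measurable_shift.
move=> ms _ [[a b] _ <-].
rewrite /= /pushforward.
have -> : (fun x : R => x + h) @^-1` `]a, b] = `]a - h, b - h]%classic.
  by apply/seteqP; split=> x; rewrite /= !in_itv/= ltrBlDr lerBrDr.
rewrite !lebesgue_measure_itv /= !lte_fin ltrD2r -!EFinB.
by rewrite opprB addrA addrNK.
Qed.

Lemma ge0_integral_shift (R : realType) (h : R) (f : measurableTypeR R ->
  \bar R) :
  measurable_fun setT f -> (forall x, (0 <= f x)%E) ->
  (\int[lebesgue_measure]_x f (x + h)%R = \int[lebesgue_measure]_x f x)%E.
Proof.
move=> mf f0.
rewrite -[LHS](ge0_integral_pushforward (measurable_shift h) _ measurableT
  mf)//.
apply: eq_measure_integral => [|mT A mA _]; first exact: measurable_shift.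
exact: lebesgue_measure_shift.
Qed.

(** Lebesgue's density theorem, used at a single point of E. *)
Lemma non_null_density (R : realType) (E : set (measurableTypeR R)) (c : R) :
  measurable E -> ~ null E -> c < 1 -> exists2 x : R, E x &
    \forall r \near 0^'+,
      ((c * (r *+ 2))%:E < lebesgue_measure (E `&` ball x r))%E.
Proof.
move=> mE nE c1; apply: contrapT => H; apply: nE.
apply: sub_null (lebesgue_density mE) => x Ex /= cvgx.
apply: H; exists x => //; move: cvgx; rewrite indicE mem_set//=.
move=> /fine_cvgP[fin /cvgr_gt/(_ _ c1)] cf; near=> r.
have r0 : 0 < r by near: r; exact: nbhs_right_gt.
have : (c%:E < lebesgue_measure (E `&` ball x r) / lebesgue_measure (ball x
  r))%E.
  have Er : (lebesgue_measure (E `&` ball x r) / lebesgue_measure (ball x r))%E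
      \is a fin_num by near: r; exact: fin.
  rewrite -(fineK Er) lte_fin; near: r; exact: cf.
rewrite lebesgue_measure_ball ?ltW// inver mulrn_eq0/= gt_eqF//.
by rewrite lte_pdivlMr ?mulrn_wgt0// -EFinM.
Unshelve. all: by end_near. Qed.

(** Otherwise take density points x of E and y of its complement.  A dyadic g
    moves x as close to y as desired, and the translate by g of the part of E
    near x stays in E.  So E and its complement would both fill most of nearly
    the same small ball around y. *)
Lemma dyadic_zero_one (R : realType) (E : set (measurableTypeR R)) :
  measurable E ->
  (forall m g x, grid m g -> E x -> E (x + g)) -> null E \/ null (~` E).
Proof.
move=> mE Einv.
have [|nE] := pselect (null E); [by left|right].
apply: contrapT => nEC; have c1 : 9 / 10 < 1 :> R by lra.
have [x Ex dx] := non_null_density mE nE c1.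
have [y Ey dy] := non_null_density (measurableC mE) nEC c1.
have [r /= [r0 [xr yr]]] : exists r : R, [/\ 0 < r,
    ((9 / 10 * (r *+ 2))%:E < lebesgue_measure (E `&` ball x r))%E &
    ((9 / 10 * (r *+ 2))%:E < lebesgue_measure (~` E `&` ball y r))%E].
  near (0 : R)^'+ => r; exists r; split.
  - by near: r; exact: nbhs_right_gt.
  - by near: r; exact: dx.
  - by near: r; exact: dy.
(* The disjoint sets A and B below have measure more than 18/10 r each, and lie
   in an interval of length 2 r + r / 10. *)
have [m mr] := @exists_expr2V_lt R (r / 10) ltac:(lra).
have [g gg /andP[xg gy]] := @grid_round_down R m (y - x).
pose A : set (measurableTypeR R) := (fun z : R =>
  z + - g) @^-1` (E `&` ball x r).
have mEx : measurable (E `&` ball x r).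
  by apply: measurableI => //; exact: measurable_ball.
have mA : measurable A by rewrite -[A]setTI; exact: measurable_shift.
have muA : lebesgue_measure A = lebesgue_measure (E `&` ball x r).
  exact: (lebesgue_measure_shift (- g) mEx).
pose B : set (measurableTypeR R) := ~` E `&` ball y r.
have mB : measurable B.
  by apply: measurableI; [exact: measurableC|exact: measurable_ball].
have AB : A `&` B = set0.
  apply/seteqP; split => // z [[Ezg _] [nEz _]]; apply: nEz.
  by rewrite -(subrK g z); exact: Einv gg Ezg.
pose I : set (measurableTypeR R) := `]y - (r + r / 10), y + r[%classic.
have mI : measurable I by exact: measurable_itv.
have ABI : A `|` B `<=` I.
  move=> z; rewrite /I/= in_itv/= => -[[_]|[_]]; rewrite /ball/= ltr_norml.
    by move=> /andP[? ?]; apply/andP; split; lra.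
  by move=> /andP[? ?]; apply/andP; split; lra.
have : (lebesgue_measure (A `|` B) <= lebesgue_measure I)%E.
  by apply: le_measure => //; rewrite inE//; exact: measurableU.
have muI : lebesgue_measure I = (2 * r + r / 10)%:E.
  apply: etrans (lebesgue_measure_itv _) _.
  rewrite /= lte_fin -EFinB.
  have -> : y - (r + r / 10) < y + r by lra.
  by congr (_%:E); lra.
have -> : lebesgue_measure (A `|` B) = (lebesgue_measure A + lebesgue_measure
  B)%E.
  exact: measureU.
rewrite muI muA; apply/negP; rewrite -ltNge.
apply: lt_trans (lteD xr yr); rewrite -EFinD lte_fin mulr2n; lra.
Unshelve. all: by end_near. Qed.

(** * Almost everywhere convergence under translations of the terms *)

(** The tails of the convergent truncated series are eventually less than 1, so
    truncation changes only finitely many terms, all of them finite. *)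
Lemma nneseries_mine1 (R : realType) (b : nat -> \bar R) :
  (forall k, (0 <= b k)%E) -> (forall k, (b k < +oo)%E) ->
  (\sum_(0 <= k <oo) mine (b k) 1 < +oo)%E -> (\sum_(0 <= k <oo) b k < +oo)%E.
Proof.
move=> b0 boo sb.
have u0 k : (0 <= mine (b k) 1)%E by rewrite le_min b0 lee01.
have : (\sum_(N <= k <oo) mine (b k) 1)%E @[N --> \oo] --> 0%E.
  by apply: nneseries_tail_cvg.
move=> /fine_cvgP[fin] /cvgr_lt/(_ _ ltr01) lt1.
have [N [Nfin N1]] : exists N, (\sum_(N <= k <oo) mine (b k) 1)%E \is a
  fin_num /\
    fine (\sum_(N <= k <oo) mine (b k) 1)%E < 1.
  near \oo => N; exists N; split; near: N; [exact: fin|exact: lt1].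
have tail1 : (\sum_(N <= k <oo) mine (b k) 1 < 1)%E by rewrite -(fineK Nfin)
  lte_fin.
have bE k : (N <= k)%N -> mine (b k) 1%E = b k.
  move=> Nk; apply/min_idPl; rewrite leNgt; apply/negP => /ltW b1.
  have : (mine (b k) 1 <= \sum_(N <= k <oo) mine (b k) 1)%E.
    apply: (@le_trans _ _ (\sum_(N <= i < k.+1) mine (b i) 1)%E).
      rewrite big_nat_recr//=; apply: leeDr; exact: sume_ge0.
    by apply: nneseries_lim_ge.
  by rewrite (min_idPr b1) leNgt tail1.
rewrite (@nneseries_split _ _ 0 N)// add0n lte_add_pinfty//.
  exact: lte_sum_pinfty.
apply: le_lt_trans (lt_trans tail1 (ltry _)).
rewrite eseries_cond [leRHS]eseries_cond.
by apply: lee_nneseries => // k /= Nk; rewrite bE.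
Unshelve. all: by end_near. Qed.

(** Stopping bound, with time running from infinity down to 0.  The terms kept
    are those reached before the accumulated sum exceeds M; the last of them,
    at the smallest such index m, adds at most 1 to a tail of at most M. *)
Lemma tail_truncated_sum (R : realType) (u : nat -> \bar R) (M : R) :
  0 <= M -> (forall k, (0 <= u k <= 1)%E) ->
  (\sum_(0 <= k <oo)
     (if \sum_(k.+1 <= i <oo) u i <= M%:E then u k else 0) <= (M + 1)%:E)%E.
Proof.
move=> M0 u01.
have u0 k : (0 <= u k)%E by have /andP[] := u01 k.
have [exk|] := pselect (exists k, (\sum_(k.+1 <= i <oo) u i <= M%:E)%E);
  last first.
  move=> /forallNP H; rewrite eseries0 ?lee_fin; last by move=> k _ _;
    case: ifP => // /H.
  lra.
have [m mM mmin] := find_ex_minn exk.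
have P0 k' : (0 <= if \sum_(k'.+1 <= i <oo) u i <= M%:E then u k' else 0)%E.
  by case: ifP.
rewrite (@nneseries_split _ _ 0 m)// add0n.
rewrite big_nat big1 ?add0e; last first.
  by move=> i /andP[_ im]; case: ifP => // /mmin; rewrite leqNgt im.
apply: (@le_trans _ _ (\sum_(m <= k <oo) u k)%E).
  by apply: lee_nneseries => // i _; case: ifP.
rewrite (@nneseries_split _ _ m 1)// addn1 big_nat1 addrC EFinD leeD//.
by have /andP[] := u01 m.
Qed.

Lemma measurable_fun_tail (R : realType) (u : nat -> measurableTypeR R ->
  \bar R) N :
  (forall k, measurable_fun setT (u k)) -> (forall k x, (0 <= u k x)%E) ->
  measurable_fun setT (fun x => (\sum_(N <= k <oo) u k x)%E).
Proof.
move=> mu u0.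
under eq_fun do rewrite eseries_cond.
exact: (@ge0_emeasurable_sum _ _ _ _ _ [pred k | N <= k]%N).
Qed.

Lemma null_integral_lty (R : realType) (f : measurableTypeR R -> \bar R) :
  measurable_fun setT f -> (forall x, (0 <= f x)%E) ->
  (\int[lebesgue_measure]_x f x < +oo)%E -> null [set x | f x = +oo%E].
Proof.
move=> mf f0 foo.
have : lebesgue_measure.-integrable setT f.
  apply/integrableP; split => //.
  by under eq_integral do rewrite gee0_abs//.
move=> /(integrable_ae measurableT); apply: sub_null => x /= fx.
by move=> /(_ Logic.I); rewrite fx.
Qed.

(** The term a_k may be translated by an amount h_k under which all later terms
    are invariant, without destroying convergence almost everywhere.  Put
    u = min(a, 1) and let B_k be the set where the tail of u after k is at most
    n.  Since B_k is invariant under h_k, the functions u_k 1_(B_k) are simply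
    translated along with u_k.  Their sum is at most n + 1 pointwise
    ([tail_truncated_sum]), so it has a finite integral over bounded intervals,
    and so has the sum of the translated functions.  If the sum of a at x is
    finite, then x lies in all B_k for n large, and there the translated
    functions are the translates of u_k themselves. *)
Lemma null_sum_shift (R : realType) (a : nat -> measurableTypeR R -> \bar R)
    (h : nat -> R) :
  (forall k, measurable_fun setT (a k)) ->
  (forall k x, (0 <= a k x)%E) -> (forall k x, (a k x < +oo)%E) ->
  (forall k, `|h k| <= 1) ->
  (forall k i x, (k < i)%N -> a i (x + h k) = a i x) ->
  null [set x | (\sum_(0 <= k <oo) a k x = +oo)%E] ->
  null [set x : R | (\sum_(0 <= k <oo) a k (x + h k)%R = +oo)%E].
Proof.
move=> ma a0 aoo h1 ah na.
pose u k x := mine (a k x) 1%E.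
have mu k : measurable_fun setT (u k) by exact: measurable_mine.
have u01 k x : (0 <= u k x <= 1)%E by rewrite le_min a0 lee01 ge_min lexx orbT.
have u0 k x : (0 <= u k x)%E by have /andP[] := u01 k x.
pose S k x := (\sum_(k.+1 <= i <oo) u i x)%E.
have mS k : measurable_fun setT (S k) by exact: measurable_fun_tail.
have Sh k x : S k (x + h k) = S k x.
  by rewrite /S eseries_cond [RHS]eseries_cond; apply: eq_eseriesr => i ki;
    rewrite /u ah.
pose B (n : nat) k : set (measurableTypeR R) := [set x | (S k x <= n%:R%:E)%E].
pose phi n k x := (u k x * (\1_(B n k) x)%:E)%E.
have mB n k : measurable (B n k).
  by rewrite -[B n k]setTI; exact: emeasurable_fun_infty_c.
have phi0 n k x : (0 <= phi n k x)%E by rewrite mule_ge0// lee_fin.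
have mphi n k : measurable_fun setT (phi n k).
  apply: emeasurable_funM => //; apply/measurable_EFinP;
    exact: measurable_indic.
have sphi n x : (\sum_(0 <= k <oo) phi n k x <= (n%:R + 1)%:E)%E.
  apply: le_trans (@tail_truncated_sum R (u^~ x) n%:R _ _) => //.
  apply: lee_nneseries => // k _; rewrite /phi indicE /B.
  case: ifPn => [kn|kn]; first by rewrite mem_set// mule1.
  by rewrite memNset ?mule0//; exact/negP.
pose D (n : nat) : set (measurableTypeR R) := `[- n%:R, n%:R]%classic.
have mD n : measurable (D n) by exact: measurable_itv.
have mshift n k : measurable_fun setT (fun x : measurableTypeR R =>
  phi n k (x + h k)).
  exact: (measurableT_comp (mphi n k) (measurable_shift (h k))).
have m1D m : measurable_fun setT (fun x : measurableTypeR R =>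
  (\1_(D m) x : R)%:E).
  by apply/measurable_EFinP; exact: measurable_indic.
(* One index n serves as the bound for the tails and for the size of x. *)
pose G n x := (\sum_(0 <= k <oo) ((\1_(D n) x)%:E * phi n k (x + h k)%R))%E.
have nG n : null [set x | G n x = +oo%E].
  apply: null_integral_lty.
  - apply: measurable_fun_tail => [k|k x]; last by rewrite mule_ge0 ?lee_fin.
    exact: emeasurable_funM.
  - by move=> x; apply: nneseries_ge0 => k _ _; rewrite mule_ge0 ?lee_fin.
  rewrite integral_nneseries//; last 2 first.
    by move=> k; exact: emeasurable_funM.
    by move=> k x _; rewrite mule_ge0 ?lee_fin.
  apply: (@le_lt_trans _ _ (\sum_(0 <= k <oo)
      \int[lebesgue_measure]_x ((\1_(D n.+1) x)%:E * phi n k x))%E).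
    apply: lee_nneseries => [k _ _|k _].
      by apply: integral_ge0 => x _; rewrite mule_ge0 ?lee_fin.
    pose f (y : measurableTypeR R) := ((\1_(D n) (y - h k)%R)%:E * phi n k y)%E.
    have mf : measurable_fun setT f.
      have m1 := measurableT_comp (m1D n) (measurable_shift (- h k)).
      exact: emeasurable_funM m1 (mphi n k).
    have f0 y : (0 <= f y)%E by rewrite mule_ge0 ?lee_fin.
    rewrite (eq_integral (fun x : measurableTypeR R => f (x + h k)%R));
      last by move=> x _; rewrite /f addrK.
    rewrite ge0_integral_shift//; apply: ge0_le_integral => //.
      exact: emeasurable_funM.
    move=> x _; apply: lee_wpmul2r => //; rewrite lee_fin !indicE ler_nat.
    case: (boolP (x - h k \in D n)) => //;
      rewrite inE /D/= in_itv/= => /andP[? ?].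
    rewrite mem_set//= in_itv/= -natr1; have := h1 k;
      rewrite ler_norml => /andP[? ?].
    by apply/andP; split; lra.
  rewrite -integral_nneseries//; last 2 first.
    by move=> k; exact: emeasurable_funM.
    by move=> k x _; rewrite mule_ge0 ?lee_fin.
  apply: (@le_lt_trans _ _
      (\int[lebesgue_measure]_x ((\1_(D n.+1) x)%:E * (n%:R + 1)%:E))%E).
    apply: ge0_le_integral => //.
    - by move=> x _; apply: nneseries_ge0 => k _ _; rewrite mule_ge0 ?lee_fin.
    - apply: measurable_fun_tail => [k|k x]; last by rewrite mule_ge0 ?lee_fin.
      exact: emeasurable_funM.
    - exact: emeasurable_funM.
    - move=> x _; rewrite nneseriesZl//; exact: lee_wpmul2l.
  rewrite ge0_integralZr//.
  rewrite integral_indic// setIT.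
  have muD : (lebesgue_measure (D n.+1) < +oo)%E.
    have -> := lebesgue_measure_itv `[- n.+1%:R, n.+1%:R : R].
    by rewrite /=; case: ifP => _; rewrite ?ltry// -EFinB ltry.
  by rewrite muleC lte_mul_pinfty// lee_fin.
apply: sub_null (nullU na (null_bigcup nG)) => x /= xoo.
have [|ax] := pselect (\sum_(0 <= k <oo) a k x = +oo)%E; [by left|right].
have su : (\sum_(0 <= k <oo) u k x < +oo)%E.
  apply: (@le_lt_trans _ _ (\sum_(0 <= k <oo) a k x)%E); last by rewrite ltey;
    apply/eqP.
  by apply: lee_nneseries => // k _; rewrite ge_min lexx.
have [n [nx nu]] : exists n : nat, `|x| <= n%:R /\ (\sum_(0 <= k <oo) u k x <=
  n%:R%:E)%E.
  have [M /andP[M0 sM]] : exists M, (0 <= M) && (\sum_(0 <= k <oo) u k x <=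
    M%:E)%E.
    exists (fine (\sum_(0 <= k <oo) u k x)%E).
    have s0 : (0 <= \sum_(0 <= k <oo) u k x)%E by exact: nneseries_ge0.
    by rewrite fine_ge0//= fineK ?lexx// ge0_fin_numE.
  exists (Num.truncn (`|x| + M)).+1.
  have /ltW lt : `|x| + M < (Num.truncn (`|x| + M)).+1%:R by exact: truncnS_gt.
  have x0 := normr_ge0 x.
  by split; [lra|apply: (le_trans sM); rewrite lee_fin; lra].
exists n => //=; apply: contrapT => Gx.
have Dx : \1_(D n) x = 1 :> R.
  by rewrite indicE mem_set// /D/= in_itv/= -ler_norml.
have : (\sum_(0 <= k <oo) a k (x + h k)%R < +oo)%E.
  apply: nneseries_mine1 => //.
  apply: (@le_lt_trans _ _ (G n x)); last by rewrite ltey; apply/eqP.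
  apply: lee_nneseries => [k _ _|k _]; first exact: u0.
  rewrite Dx mul1e /phi indicE mem_set ?mule1// /B/= Sh.
  apply: le_trans nu; rewrite /S eseries_cond; exact: subset_lee_nneseries.
by rewrite xoo ltxx.
Qed.

(** * Sums over a dyadic grid *)

Lemma subset_le_esum (R : realType) (T : choiceType) (A B : set T) (a : T ->
  \bar R) :
  (forall t, (0 <= a t)%E) -> A `<=` B ->
  (\esum_(t in A) a t <= \esum_(t in B) a t)%E.
Proof.
move=> a0 AB; rewrite [leRHS](esumID A)// (_ : B `&` A = A);
  last exact/setIidPr.
by rewrite leeDl//; apply: esum_ge0.
Qed.

Lemma esum_le_setU (R : realType) (T : choiceType) (A B C : set T) (a : T ->
  \bar R) :
  (forall t, (0 <= a t)%E) -> C `<=` A `|` B ->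
  (\esum_(t in C) a t <= \esum_(t in A) a t + \esum_(t in B) a t)%E.
Proof.
move=> a0 CAB; rewrite (esumID A C)// leeD//;
  apply: subset_le_esum => // t [] //.
by move=> /CAB[].
Qed.

Definition grid_sum (R : realType) m (F : R -> \bar R) (x : R) : \bar R :=
  \esum_(g in grid m) F (x + g).

Lemma grid_sum_ge0 (R : realType) m (F : R -> \bar R) x :
  (forall t, (0 <= F t)%E) -> (0 <= grid_sum m F x)%E.
Proof. by move=> F0; apply: esum_ge0. Qed.

Lemma grid_sum_periodic (R : realType) m (F : R -> \bar R) (h x : R) :
  grid m h -> grid_sum m F (x + h) = grid_sum m F x.
Proof.
move=> gh; rewrite /grid_sum [RHS](reindex_esum (grid m) _ (fun g => h + g)).
  by apply: eq_esum => g _; rewrite addrA.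
split.
- by move=> g gg; exact: gridD.
- by move=> ? ? _ _ /addrI.
- by move=> g gg; exists (g - h); [exact: gridB|rewrite addrC subrK].
Qed.

(** When the step is at most halved, the new grid is covered by the old one and
    its translate by the new step. *)
Lemma grid_sum_refine (R : realType) m m' (F : R -> \bar R) (x : R) :
  (forall t, (0 <= F t)%E) -> (m <= m' <= m.+1)%N ->
  (grid_sum m' F x <= grid_sum m F x + grid_sum m F (x + 2 ^- m'))%E.
Proof.
move=> F0 /andP[mm' m'm].
have -> : grid_sum m F (x + 2 ^- m') =
    \esum_(g in [set 2 ^- m' + g | g in grid m]) F (x + g).
  rewrite (reindex_esum (grid m) _ (fun g => 2 ^- m' + g)).
    by apply: eq_esum => g _; rewrite addrA.
  by split => // ? ? _ _ /addrI.
apply: esum_le_setU => // g gg.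
have [E|E] : m' = m \/ m' = m.+1 by lia.
  by left; rewrite -E.
rewrite E in gg *; have [gm|gm] := gridS_split gg; [by left|right].
by exists (g - 2 ^- m.+1) => //; rewrite addrC subrK.
Qed.

Lemma grid_bij_nat (R : realType) m :
  exists gam : nat -> R, set_bij [set: nat] (grid m) gam.
Proof.
apply/card_set_bijP; rewrite card_eq_sym; apply: eq_card_nat.
  exact: card_le_trans (card_image_le _ _) (countableP _).
apply: unbounded_infinite_set => t; exists (Num.truncn t).+1%:R;
  first exact: grid_nat.
exact: truncnS_gt.
Qed.

Lemma measurable_grid_sum (R : realType) m (F : measurableTypeR R -> \bar R) :
  measurable_fun setT F -> (forall t, (0 <= F t)%E) ->
  measurable_fun setT (grid_sum m F : measurableTypeR R -> \bar R).
Proof.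
move=> mF F0; have [gam bij] := @grid_bij_nat R m.
have -> : grid_sum m F = fun x => (\sum_(0 <= n <oo) F (x + gam n)%R)%E.
  apply/funext => x; rewrite /grid_sum (reindex_esum _ _ _ _ bij).
  by rewrite nneseries_esumT.
apply: measurable_fun_tail => // k.
exact: (measurableT_comp mF (measurable_shift (gam k))).
Qed.

Lemma finite_grid_itv (R : realType) m (M : R) :
  finite_set (grid m `&` [set g | `|g| <= M]).
Proof.
pose N := (Num.truncn (M * 2 ^+ m)).+1.
apply: (@sub_finite_set _ _
  ((fun n : nat => (n%:Z - N%:Z)%:~R / 2 ^+ m : R) @` `I_(N + N))); last first.
  exact/finite_image/finite_II.
move=> _ [[i _ <-]] /=; rewrite ler_norml => /andP[].
have P0 : 0 < 2 ^+ m :> R by rewrite exprn_gt0.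
rewrite ler_pdivlMr// ler_pdivrMr// mulNr => lo hi.
have MN : M * 2 ^+ m < N%:R by exact: truncnS_gt.
have hiN : i < N%:Z by rewrite -(ltr_int R); lra.
have loN : - N%:Z < i by rewrite -(ltr_int R) rmorphN/=; lra.
exists (absz (i + N%:Z)); first by rewrite /=; lia.
by congr (_%:~R / _); lia.
Qed.

Lemma grid_sum_lty (R : realType) m (F : R -> \bar R) (M x : R) :
  (forall t, (0 <= F t < +oo)%E) -> (forall t, M < `|t| -> F t = 0%E) ->
  (grid_sum m F x < +oo)%E.
Proof.
move=> F0oo F0M.
have F0 t : (0 <= F t)%E by have /andP[] := F0oo t.
pose S := [set g : R | `|g| <= M + `|x|].
rewrite /grid_sum (esumID S)//.
have fin : finite_set (grid m `&` S) by exact: finite_grid_itv.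
rewrite [X in (_ + X)%E]esum1 => [|g [_ /negP]]; last first.
  rewrite -ltNge => Mg; apply: F0M.
  by have := ler_normB (x + g) x; rewrite addrAC subrr add0r; lra.
rewrite adde0 esum_fset// fsbig_finite//=; apply: lte_sum_pinfty => g _.
by have /andP[] := F0oo (x + g).
Qed.

(** * Sums with the step read off from a fixed origin *)

Definition window (R : realType) (f : R -> R) (c : R) (k : nat) : R -> \bar R :=
  (EFin \o f) \_ `[c + k%:R, c + k.+1%:R[%classic.

(** The sum of f over the points y >= c for which y - x is on the grid of step
    2^-e(floor (y - c)); see [comb_sumE].  In the sum of f over the translate of
    [refining_grid e] by x the step depends on floor (y - x); here it depends on
    y alone, so that each part is exactly periodic in x. *)
Definition comb_sum (R : realType) (e : nat -> nat) (f : R ->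
  R) (c x : R) : \bar R :=
  \sum_(0 <= k <oo) grid_sum (e k) (window f c k) x.

Lemma window_ge0 (R : realType) (f : R -> R) c k t :
  (forall t, 0 <= f t) -> (0 <= window f c k t)%E.
Proof. by move=> f0; rewrite /window patchE; case: ifP => // _;
  rewrite lee_fin. Qed.

Lemma measurable_window (R : realType) (f : R -> R) c k :
  measurable_fun setT f ->
  measurable_fun setT (window f c k : measurableTypeR R -> \bar R).
Proof.
move=> mf; apply: (measurable_restrictT _ _).1; first exact: measurable_itv.
apply: measurable_funTS.
have mEf : measurable_fun setT (EFin \o f) by exact/measurable_EFinP.
by move=> mT Y mY; exact: mEf.
Qed.

Lemma window_shift (R : realType) (f : R -> R) c k :
  window f c k.+1 = window f (c + 1) k.
Proof.
by rewrite /window -!addrA -!natr1 [1 + _]addrC [1 + (_ + _)]addrC.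
Qed.

Lemma grid_sum_window_lty (R : realType) (f : R -> R) c m k x :
  (forall t, 0 <= f t) -> (grid_sum m (window f c k) x < +oo)%E.
Proof.
move=> f0; apply: (@grid_sum_lty _ _ _ (`|c| + k.+1%:R)) => t.
  by rewrite window_ge0// /window patchE; case: ifP => //= _; exact: ltry.
move=> ct; rewrite /window patchE memNset//= in_itv/=.
rewrite -natr1 => /andP[lo hi]; move: ct; rewrite ltNge => /negP; apply.
have k0 : 0 <= k%:R :> R by exact: ler0n.
have := ler_norm c; have := ler_norm (- c);
  rewrite normrN -natr1 ler_norml => ? ?.
by apply/andP; split; lra.
Qed.

Lemma comb_sumE (R : realType) e (f : R ->
  R) (c x : R) : (forall t, 0 <= f t) ->
  comb_sum e f c x =
  \esum_(l in [set l | c <= x + l /\ grid (e (Num.truncn (x + l - c))) l]) (f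
    (x + l))%:E.
Proof.
move=> f0.
pose J k : set R :=
  grid (e k) `&` [set l | (`[c + k%:R, c + k.+1%:R[%classic : set R) (x + l)].
have JE k l : J k l -> 0 <= x + l - c /\ Num.truncn (x + l - c) = k.
  move=> [_]; rewrite /= in_itv/= => /andP[? ?]; split.
    by have : 0 <= k%:R :> R by []; lra.
  by apply: truncn_def; apply/andP; split; lra.
have -> : [set l | c <= x + l /\ grid (e (Num.truncn (x + l - c))) l] =
    \bigcup_(k in [set: nat]) J k.
  apply/seteqP; split => [l [cl gl]|l [k _ Jl]].
    exists (Num.truncn (x + l - c)) => //; split => //.
    have : 0 <= x + l - c by lra.
    by move=> /truncn_itv/andP[? ?]; rewrite /= in_itv/=; apply/andP; split;
      lra.
  have [l0 lk] := JE _ _ Jl; rewrite /= lk; split; first by lra.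
  by have [] := Jl.
rewrite esum_bigcupT; last 2 first.
- apply/trivIsetP => i j _ _ ij; apply/seteqP;
  split => // l [/JE[_ li] /JE[_ lj]].
  by rewrite -li -lj eqxx in ij.
- by move=> l; rewrite lee_fin.
rewrite /comb_sum nneseries_esumT; last by move=> k; apply: grid_sum_ge0 => t;
  exact: window_ge0.
apply: eq_esum => k _; rewrite esum_mkcondr; apply: eq_esum => l _.
by rewrite /window patchE; congr (if _ then _ else _).
Qed.

(** Reading the step off from an origin further to the left refines every
    grid. *)
Lemma translate_sum_le_comb (R : realType) e (f : R -> R) (c x : R) :
  {homo e : i j / (i <= j)%N} -> (forall t, 0 <= f t) -> c <= x ->
  (translate_sum f (refining_grid e) x <= comb_sum e f c x)%E.
Proof.
move=> he f0 cx; rewrite comb_sumE//; apply: subset_le_esum => [t|l [l0 gl]].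
  by rewrite lee_fin.
split; first by lra.
by apply: sub_grid gl; apply: he; apply: le_truncn; lra.
Qed.

Lemma comb_le_translate_sum (R : realType) e (f : R -> R) (c x : R) :
  {homo e : i j / (i <= j)%N} -> (forall t, 0 <= f t) -> x <= c ->
  (comb_sum e f c x <= translate_sum f (refining_grid e) x)%E.
Proof.
move=> he f0 cx; rewrite comb_sumE//; apply: subset_le_esum => [t|l [l0 gl]].
  by rewrite lee_fin.
split; first by lra.
by apply: sub_grid gl; apply: he; apply: le_truncn; lra.
Qed.

Lemma measurable_comb_sum (R : realType) e (f : R -> R) c :
  measurable_fun setT f -> (forall t, 0 <= f t) ->
  measurable_fun setT (comb_sum e f c : measurableTypeR R -> \bar R).
Proof.
move=> mf f0; apply: measurable_fun_tail => [k|k x].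
  by apply: measurable_grid_sum => [|t];
    [exact: measurable_window|exact: window_ge0].
by apply: grid_sum_ge0 => t; exact: window_ge0.
Qed.

(** A dyadic number is a period of all but finitely many parts, and each part is
    a finite sum, because the window is bounded. *)
Lemma comb_sum_lty_dyadic (R : realType) e (f : R -> R) (c x g : R) m :
  {homo e : i j / (i <= j)%N} -> (forall m, exists k, (m <= e k)%N) ->
  (forall t, 0 <= f t) -> grid m g ->
  (comb_sum e f c x < +oo)%E -> (comb_sum e f c (x + g) < +oo)%E.
Proof.
move=> he e_unb f0 gg; have [K mK] := e_unb m.
have s0 k y : (0 <= grid_sum (e k) (window f c k) y)%E.
  by apply: grid_sum_ge0 => t; exact: window_ge0.
rewrite /comb_sum (@nneseries_split _ _ 0 K)// [in X in _ ->
  X](@nneseries_split _ _ 0 K)//.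
rewrite !add0n => xoo; apply: lte_add_pinfty.
  by apply: lte_sum_pinfty => k _; exact: grid_sum_window_lty.
apply: le_lt_trans xoo.
have -> : (\sum_(K <= k <oo) grid_sum (e k) (window f c k) (x + g) =
    \sum_(K <= k <oo) grid_sum (e k) (window f c k) x)%E.
  rewrite eseries_cond [RHS]eseries_cond; apply: eq_eseriesr => k /= Kk.
  by apply: grid_sum_periodic; apply: sub_grid gg; apply: (leq_trans mK);
    exact: he.
by rewrite leeDr//; apply: sume_ge0.
Qed.

Lemma comb_sum_zero_one (R : realType) e (f : R -> R) (c : R) :
  {homo e : i j / (i <= j)%N} -> (forall m, exists k, (m <= e k)%N) ->
  measurable_fun setT f -> (forall t, 0 <= f t) ->
  null [set x | (comb_sum e f c x < +oo)%E] \/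
  null [set x | comb_sum e f c x = +oo%E].
Proof.
move=> he e_unb mf f0.
pose E : set (measurableTypeR R) := [set x | (comb_sum e f c x < +oo)%E].
have mE : measurable E.
  rewrite -[E]setTI; apply: emeasurable_fun_infty_o => //.
  exact: measurable_comb_sum.
have [|nE|nE] := dyadic_zero_one mE; [|by left|right].
  by move=> m g x gg; exact: (comb_sum_lty_dyadic he e_unb f0 gg).
by apply: sub_null nE => x /= xoo; rewrite /E /= xoo ltxx.
Qed.

(** On the window [c + 1 + k, c + 2 + k) the sum from c uses the grid of
    exponent e (k + 1) and the sum from c + 1 that of exponent e k.  By
    [grid_sum_refine] the former is at most the latter plus its translate by
    2^-e(k+1), which is a period of all later parts, so [null_sum_shift]
    applies.  The first window of the sum from c contributes a finite term. *)
Lemma null_comb_sum_step (R : realType) e (f : R -> R) (c : R) :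
  {homo e : i j / (i <= j)%N} -> (forall k, e k.+1 <= (e k).+1)%N ->
  measurable_fun setT f -> (forall t, 0 <= f t) ->
  null [set x | comb_sum e f (c + 1) x = +oo%E] ->
  null [set x | comb_sum e f c x = +oo%E].
Proof.
move=> he e1 mf f0 n1.
pose a k (x : measurableTypeR R) := grid_sum (e k) (window f (c + 1) k) x.
pose h k : R := 2 ^- e k.+1.
have w0 c' k t : (0 <= window f c' k t)%E by exact: window_ge0.
have a0 k x : (0 <= a k x)%E by exact: grid_sum_ge0.
have nh := @null_sum_shift R a h _ a0 _ _ _ n1.
apply: sub_null (nullU n1 (nh _ _ _ _)) => [x xoo||||].
- have [|ax] := pselect (comb_sum e f (c + 1) x = +oo%E); [by left|right].
  apply/eqP; rewrite -leye_eq leNgt; apply/negP => ahx.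
  suff : (comb_sum e f c x < +oo)%E by rewrite xoo ltxx.
  rewrite /comb_sum (@nneseries_split _ _ 0 1)//; last by move=> k _;
    exact: grid_sum_ge0.
  rewrite add0n big_nat1 lte_add_pinfty//; first exact: grid_sum_window_lty.
  apply: (@le_lt_trans _ _ (\sum_(0 <= k <oo) (a k x + a k (x + h k)%R))%E).
    rewrite -nneseries_addn; last by move=> k; exact: grid_sum_ge0.
    apply: lee_nneseries => [k _ _|k _]; first exact: grid_sum_ge0.
    rewrite addn1 window_shift; apply: grid_sum_refine => //.
    by rewrite e1 he.
  rewrite nneseriesD//; apply: lte_add_pinfty => //.
  by rewrite ltey; apply/eqP.
- move=> k; apply: measurable_grid_sum => //; exact: measurable_window.
- by move=> k x; apply: grid_sum_window_lty.
- by move=> k; rewrite ger0_norm ?expr2V_le1// invr_ge0 exprn_ge0.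
- move=> k i x ki; apply: grid_sum_periodic; apply: sub_grid (grid_step _ _).
  exact: he.
Qed.

(** If the sum s over the translates is finite on a non-null set, so is the comb
    sum from some origin n, since it is at most s to the left of n.  By the
    zero-one law it is then finite almost everywhere; stepping down, so are the
    comb sums from all n - j, and they bound s on [n - j, +oo). *)
Lemma refining_grid_dichotomy (R : realType) e (f : R -> R) :
  {homo e : i j / (i <= j)%N} -> (forall m, exists k, (m <= e k)%N) ->
  (forall k, e k.+1 <= (e k).+1)%N ->
  measurable_fun setT f -> (forall t, 0 <= f t) ->
  null (divergence_set f (refining_grid e)) \/
  null (convergence_set f (refining_grid e)).
Proof.
move=> he e_unb e1 mf f0.
have [|nC] := pselect (null (convergence_set f (refining_grid e)));
  [by right|left].
have [n nn] : exists n : nat, ~ null [set x | (comb_sum e f n%:R x < +oo)%E].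
  apply: contrapT => /forallNP H; apply: nC.
  apply: sub_null (null_bigcup
    (A := fun n : nat => [set x | (comb_sum e f n%:R x < +oo)%E]) _).
    move=> x xoo; exists (Num.truncn x).+1 => //=.
    by apply: le_lt_trans xoo; apply: comb_le_translate_sum => //;
      exact/ltW/truncnS_gt.
  by move=> n; apply: contrapT; exact: H.
have nj j : null [set x | comb_sum e f (n%:R - j%:R) x = +oo%E].
  elim: j => [|j IH].
    by rewrite subr0; case: (comb_sum_zero_one n%:R he e_unb mf f0).
  apply: null_comb_sum_step => //.
  by rewrite -natr1 opprD addrA subrK.
apply: sub_null (null_bigcup nj) => x xoo.
exists (Num.truncn (n%:R - x)).+1 => //=.
apply/eqP; rewrite -leye_eq -xoo; apply: translate_sum_le_comb => //.
by have := truncnS_gt (n%:R - x); lra.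
Qed.

(** * Short jumps give type 1 *)

Lemma null_shift (R : realType) (h : R) (A : set R) :
  null A -> null [set x | A (x + h)].
Proof.
move=> [N [mN N0 AN]].
exists ((fun x : R => x + h) @^-1` N); split.
- by rewrite -[X in measurable X]setTI; exact: measurable_shift.
- by rewrite -N0; exact: (lebesgue_measure_shift h mN).
- by move=> x; exact: AN.
Qed.

Lemma null_bigcup_countable (R : realType) (T : countType) (A : T -> set R) :
  (forall t, null (A t)) -> null (\bigcup_t A t).
Proof.
move=> nA.
have nB : null (\bigcup_n if unpickle n is Some t then A t else set0).
  apply: null_bigcup => n; case: unpickle => [t|]; first exact: nA.
  exact: negligible_set0.
apply: sub_null nB => x [t _ Ax]; exists (pickle t); first exact: I.
by rewrite pickleK.
Qed.

Lemma lebesgue_measurable_setP (R : realType) (E : set R) :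
  measurable (E : set (lebesgueType R)) ->
  exists A N : set (measurableTypeR R), [/\ measurable A, null N & E = A `|` N].
Proof.
rewrite -[measurable _]/(((wlength idfun)^*%mu.-cara.-measurable) E).
rewrite -completed_caratheodory_measurable g_sigma_completed_algebra_genE.
by move=> [A mA [N nN <-]]; exists A, N.
Qed.

(** Each superlevel set of f at a rational height is Borel up to a null set.
    Let Z be a Borel null set containing these countably many null sets: the
    function equal to f off Z and to 0 on Z has Borel superlevel sets. *)
Lemma lebesgue_ae_eq_borel (R : realType) (f : R -> R) :
  lebesgue_measurable_fun f -> (forall x, 0 <= f x) ->
  exists g : R -> R, [/\ measurable_fun setT g, forall x, 0 <= g x &
    null [set x | f x != g x]].
Proof.
move=> mf f0.
have /choice[A /choice[N AN]] : forall q : rat,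
    exists A N : set (measurableTypeR R),
    [/\ measurable A, null N & [set x | ratr q < f x] = A `|` N].
  move=> q; apply: lebesgue_measurable_setP.
  have := mf measurableT `]ratr q, +oo[%classic (measurable_itv _).
  by rewrite setTI; congr (measurable _); apply/seteqP; split => x;
    rewrite /= in_itv/= andbT.
have [Z [mZ Z0 NZ]] : null (\bigcup_q N q).
  by apply: null_bigcup_countable => q; have [] := AN q.
have {}NZ q x : N q x -> Z x by move=> Nx; apply: NZ; exists q.
exists (f \_ (~` Z)); split.
- apply: (measurability _ (RGenOInfty.measurableE R)) => _ [_ [r ->] <-].
  rewrite setTI; have [r0|r0] := ltP r 0.
    rewrite (_ : _ @^-1` _ = setT) //.
    apply/seteqP; split => // x _; rewrite /= in_itv/= andbT patchE.
    by case: ifP => // _; exact: lt_le_trans (f0 x).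
  rewrite (_ : _ @^-1` _ =
      (\bigcup_(q : rat) (if r < ratr q then A q else set0)) `&` ~` Z).
    apply: measurableI; last exact: measurableC.
    by apply: bigcupT_measurable_rat => q; case: ifP => // _; have [] := AN q.
  apply/seteqP; split => x; rewrite /= in_itv/= andbT patchE.
    case: ifPn => [|_ /(le_lt_trans r0)]; last by rewrite ltxx.
    rewrite inE => Zx rf; split => //.
    have [q] := rat_in_itvoo rf; rewrite in_itv/= => /andP[rq qf].
    exists q => //; rewrite rq; have [_ _ E] := AN q.
    have : [set x | ratr q < f x] x by [].
    by rewrite E => -[//|/NZ].
  move=> [[q _]]; case: ifP => // rq Aq Zx; rewrite mem_set//.
  have [_ _ E] := AN q; apply: (lt_trans rq).
  suff : [set x | ratr q < f x] x by [].
  by rewrite E; left.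
- by move=> x; rewrite patchE; case: ifP.
- exists Z; split => // x /= fx; apply: contrapT => Zx; move/eqP: fx; apply.
  by rewrite patchE mem_set.
Qed.

(** Replacing f by a Borel function that agrees with it almost everywhere
    changes the sums only at the points of countably many translates of a null
    set. *)
Lemma type1_refining_grid (R : realType) e :
  {homo e : i j / (i <= j)%N} -> (forall m, exists k, (m <= e k)%N) ->
  (forall k, e k.+1 <= (e k).+1)%N -> type1 (@refining_grid R e).
Proof.
move=> he e_unb e1; split; first exact: refining_grid_admissible.
move=> f mf f0; have [g [mg g0 fg]] := lebesgue_ae_eq_borel mf f0.
pose N n := [set x : R | f (x + grid_walk R e n) != g (x + grid_walk R e n)].
have nN : null (\bigcup_n N n).
  by apply: null_bigcup => n; exact: (null_shift (grid_walk R e n) fg).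
have sfg x : ~ (\bigcup_n N n) x ->
    translate_sum f (refining_grid e) x = translate_sum g (refining_grid e) x.
  move=> Nx; apply: eq_esum => l; rewrite -range_grid_walk// => -[n _ <-].
  congr (_%:E); apply: contrapT => /eqP fgx; apply: Nx; by exists n.
have [nD|nC] := refining_grid_dichotomy he e_unb e1 mg g0; [left|right].
- apply/completed_lebesgue_measure0P; apply: sub_null (nullU nD nN) => x.
  have [|/sfg E] := pselect ((\bigcup_n N n) x); first by right.
  by rewrite /divergence_set/= E; left.
- apply/completed_lebesgue_measure0P; apply: sub_null (nullU nC nN) => x.
  have [|/sfg E] := pselect ((\bigcup_n N n) x); first by right.
  by rewrite /convergence_set/= E; left.
Qed.

(** * The two sets *)

(** On the k with 2^t <= k + 1 < 2^(t+1) the exponent climbs if t has parity p,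
    and stalls at 2^t otherwise. *)
Definition stalling (p : bool) (k : nat) : nat :=
  if odd (trunc_log 2 k.+1) == p then k.+1 else (2 ^ trunc_log 2 k.+1)%N.

Lemma stalling_bounds p k :
  (2 ^ trunc_log 2 k.+1 <= stalling p k <= k.+1)%N.
Proof.
have /andP[lo hi] := @trunc_log_bounds 2 k.+1 isT isT.
by rewrite /stalling; case: ifP => _; rewrite ?lo ?leqnn.
Qed.

Lemma stalling_homo p : {homo stalling p : i j / (i <= j)%N}.
Proof.
move=> i j ij; have tij : (trunc_log 2 i.+1 <= trunc_log 2 j.+1)%N.
  exact: leq_trunc_log.
move: tij; rewrite leq_eqVlt => /orP[/eqP E|lt].
  by rewrite /stalling E; case: ifP.
have /andP[_ hi] := stalling_bounds p i;
  have /andP[lo _] := stalling_bounds p j.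
apply: (leq_trans hi); apply: leq_trans lo.
have /andP[_] := @trunc_log_bounds 2 i.+1 isT isT.
by move=> /ltnW /leq_trans; apply; rewrite leq_exp2l.
Qed.

(** The jump is at the end of a block on which the exponent stalls. *)
Lemma stalling_jump p j : exists k, (stalling p k + j <= stalling p k.+1)%N.
Proof.
(* Large, and not of parity p; then k + 2 = 2^(t+1) starts a climbing block. *)
pose t := (j.*2 + ~~ p)%N.
have jt : (j < 2 ^ t)%N.
  by apply: (leq_trans (ltn_expl j (isT : 1 < 2)%N)); rewrite leq_exp2l// /t;
    lia.
have t0 : (0 < 2 ^ t)%N by rewrite expn_gt0.
exists (2 ^ t.+1 - 2)%N.
have E1 : ((2 ^ t.+1 - 2).+1 = 2 ^ t.+1 - 1)%N by rewrite expnS; lia.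
have T : trunc_log 2 (2 ^ t.+1 - 2).+1 = t.
  by rewrite E1; apply: trunc_log_eq => //; rewrite expnS; lia.
have T' : trunc_log 2 (2 ^ t.+1 - 2).+2 = t.+1.
  by rewrite E1; apply: trunc_log_eq => //; rewrite !expnS; lia.
have ot : odd t = ~~ p by rewrite /t oddD odd_double oddb.
rewrite /stalling T T' /= ot negbK eqxx; case: (p) => /=; rewrite expnS; lia.
Qed.

Lemma maxn_stalling k : maxn (stalling false k) (stalling true k) = k.+1.
Proof.
have /andP[lo hi] := @trunc_log_bounds 2 k.+1 isT isT.
by rewrite /stalling; case: odd => /=; [apply/maxn_idPr|apply/maxn_idPl].
Qed.

Lemma refining_gridU (R : realType) e e' :
  @refining_grid R e `|` refining_grid e' =
  refining_grid (fun k => maxn (e k) (e' k)).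
Proof.
apply/seteqP; split => [t [|] [t0 gt]|t [t0]].
- by split => //; apply: sub_grid gt; exact: leq_maxl.
- by split => //; apply: sub_grid gt; exact: leq_maxr.
- by rewrite /maxn; case: ifP => _ gt; [right|left].
Qed.

Theorem proposition4p2 (R : realType) :
  exists L1 L2 : set R,
    [/\ decreasing_gap_asymptotically_dense L1, type2 L1,
        decreasing_gap_asymptotically_dense L2, type2 L2
      & type1 (L1 `|` L2)].
Proof.
have unb p m : exists k, (m <= stalling p k)%N.
  by have [k] := stalling_jump p m; exists k.+1; lia.
exists (refining_grid (stalling false)), (refining_grid (stalling true)); split.
- by apply: refining_grid_decreasing_gap; [exact: stalling_homo|exact: unb].
- by apply: type2_refining_grid; [exact: stalling_homo|exact: stalling_jump].
- by apply: refining_grid_decreasing_gap; [exact: stalling_homo|exact: unb].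
- by apply: type2_refining_grid; [exact: stalling_homo|exact: stalling_jump].
rewrite refining_gridU; have -> : (fun k =>
  maxn (stalling false k) (stalling true k)) = succn.
  by apply/funext => k; exact: maxn_stalling.
by apply: type1_refining_grid => // m; exists m.
Qed.
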